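(* Let $(K,v)$ be a valued field, $(L,v)$ a valued field extension of $(K,v)$, and $a,b\in L$. If $a$ is a homogeneous approximation of $b$ over $K$, then $a$ lies in the henselization of $K(b)$ with respect to every extension of the valuation $v$ from $K(a,b)$ to the algebraic closure $\widetilde{K(b)}$ of $K(b)$.
   Context: Valuations are Krull valuations of arbitrary rank, written additively. $\tilde K$ denotes the algebraic closure of $K$, $K^{\mathrm{sep}}$ its separable-algebraic closure, and $\mathrm{Gal}\,K=\mathrm{Gal}(K^{\mathrm{sep}}|K)$. An element $a$ in a valued field extension of $(K,v)$ is called strongly homogeneous over $(K,v)$ if $a\in K^{\mathrm{sep}}\setminus K$, the extension of $v$ from $K$ to $K(a)$ is unique, and $$va=\mathrm{kras}(a,K):=\max\{v(\tau a-\sigma a)\mid \sigma,\tau\in\mathrm{Gal}\,K \text{ and } \tau a\neq\sigma a\}\in v\tilde K,$$ where $v$ is extended to $\tilde K$. An element $a\in L$ is called a homogeneous approximation of $b\in L$ over $K$ if there is some $d\in K$ such that $a-d$ is strongly homogeneous over $K$ and $v(b-a)>v(b-d)\geq vb$. The henselization of $K(b)$ with respect to a valuation $v$ on $\widetilde{K(b)}$ is the henselization of $(K(b),v)$ inside $(\widetilde{K(b)},v)$ (the decomposition field). Note that $a$ is algebraic over $K$, so that $K(a,b)$ is regarded as a subfield of $\widetilde{K(b)}$. *)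

(* Defs.v *)
From HB Require Import structures.
From mathcomp Require Import all_boot all_order all_algebra all_field.
From mathcomp Require Import boolp.

Set Implicit Arguments.
Unset Strict Implicit.
Unset Printing Implicit Defensive.

Import Order.TTheory GRing.Theory Num.Theory.
Local Open Scope ring_scope.

(* Totally ordered abelian groups: [porderZmodType] requires neither totality
   nor the compatibility of the order with addition. *)
HB.mixin Record isOrderedZmodule G of Num.POrderedZmodule G := {
  ozmod_total : total (<=%R : rel G);
  ozmod_leD2r : forall x y z : G, x <= y -> x + z <= y + z
}.

#[short(type="ozmodType")]
HB.structure Definition OrderedZmodule :=
  { G of Num.POrderedZmodule G & isOrderedZmodule G }.

(* The values are in G u {oo}, encoded as [option G] with [None] for oo. *)
Section ExtendedGroup.
Variable G : ozmodType.

Definition vle (x y : option G) : bool :=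
  match x, y with
  | _, None => true
  | None, Some _ => false
  | Some g, Some h => g <= h
  end.

Definition vlt (x y : option G) : bool := ~~ vle y x.

Definition vadd (x y : option G) : option G :=
  match x, y with
  | Some g, Some h => Some (g + h)
  | _, _ => None
  end.

End ExtendedGroup.

(* Krull valuations of arbitrary rank. The value group v F is the image of F^*,
   which need not be the whole of G. *)
Record valuation (F : fieldType) (G : ozmodType) := Valuation {
  val_fun :> F -> option G;
  val_eqoo : forall x, (val_fun x == None) = (x == 0);
  val_mul : forall x y, val_fun (x * y) = vadd (val_fun x) (val_fun y);
  val_add : forall x y, vle (val_fun x) (val_fun (x + y))
                     || vle (val_fun y) (val_fun (x + y))
}.

Section Restriction.
Variables (F E : fieldType) (G : ozmodType).
Variables (f : {rmorphism F -> E}) (w : valuation E G).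

Let res_fun x := w (f x).

Fact res_eqoo x : (res_fun x == None) = (x == 0).
Proof. by rewrite /res_fun val_eqoo fmorph_eq0. Qed.

Fact res_mul x y : res_fun (x * y) = vadd (res_fun x) (res_fun y).
Proof. by rewrite /res_fun rmorphM val_mul. Qed.

Fact res_add x y : vle (res_fun x) (res_fun (x + y))
                || vle (res_fun y) (res_fun (x + y)).
Proof. by rewrite /res_fun rmorphD val_add. Qed.

Definition restrict_val : valuation F G := Valuation res_eqoo res_mul res_add.

End Restriction.

(* Valuations are identified when they differ by an order isomorphism of their
   value groups. *)
Definition val_equiv (F : fieldType) (G H : ozmodType)
    (v : valuation F G) (w : valuation F H) : Prop :=
  forall x y, vle (v x) (v y) = vle (w x) (w y).

Definition val_extends (F E : fieldType) (G H : ozmodType)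
    (f : {rmorphism F -> E}) (v : valuation F G) (w : valuation E H) : Prop :=
  val_equiv v (restrict_val f w).

Section Subfield.
Variables (L : fieldType) (S : divringClosed L).

Record subfield_of : predArgType :=
  Subfield { subfield_val : L; _ : subfield_val \in S }.

HB.instance Definition _ := [isSub for subfield_val].
HB.instance Definition _ := [Choice of subfield_of by <:].
HB.instance Definition _ := [SubChoice_isSubIntegralDomain of subfield_of by <:].
HB.instance Definition _ := [SubIntegralDomain_isSubField of subfield_of by <:].

Definition subfield_incl : {rmorphism subfield_of -> L} :=
  GRing.RMorphism.clone _ _ (\val : subfield_of -> L) _.

Section Corestriction.
Variables (F : fieldType) (f : {rmorphism F -> L}).
Hypothesis fS : forall c, f c \in S.

Definition corestr_fun (c : F) : subfield_of := Subfield (fS c).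

Fact corestr_zmod : zmod_morphism corestr_fun.
Proof. by move=> x y; apply: val_inj; rewrite raddfB /= rmorphB. Qed.

Fact corestr_monoid : monoid_morphism corestr_fun.
Proof.
by split=> [|x y]; apply: val_inj; rewrite ?rmorph1 //= ?rmorph1 ?rmorphM.
Qed.

HB.instance Definition _ :=
  GRing.isZmodMorphism.Build F subfield_of corestr_fun corestr_zmod.
HB.instance Definition _ :=
  GRing.isMonoidMorphism.Build F subfield_of corestr_fun corestr_monoid.

Definition corestr : {rmorphism F -> subfield_of} := corestr_fun.

End Corestriction.
End Subfield.

Section Adjoin.
Variables (F L : fieldType) (f : {rmorphism F -> L}) (a : L).

Definition adjoin_pred : {pred L} := fun x =>
  `[< forall S : {pred L}, divring_closed S ->
        (forall c, f c \in S) -> a \in S -> x \in S >].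

Fact adjoin_divring : divring_closed adjoin_pred.
Proof.
split=> [|x y /asboolP xP /asboolP yP|x y /asboolP xP /asboolP yP];
  apply/asboolP => S divS fS aS; have [S1 SB SD] := divS => //.
- by apply: SB; [apply: xP | apply: yP].
- by apply: SD; [apply: xP | apply: yP].
Qed.

HB.instance Definition _ := GRing.isDivringClosed.Build L adjoin_pred
  adjoin_divring.

Fact adjoin_base c : f c \in adjoin_pred.
Proof. by apply/asboolP => S _ fS _; apply: fS. Qed.

Fact adjoin_gen : a \in adjoin_pred.
Proof. by apply/asboolP => S _ _ aS. Qed.

Definition adjoin : fieldType := subfield_of adjoin_pred.
Definition adjoin_incl : {rmorphism adjoin -> L} := subfield_incl adjoin_pred.
Definition to_adjoin : {rmorphism F -> adjoin} := corestr adjoin_base.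
Definition adjoin_elt : adjoin := Subfield adjoin_gen.

End Adjoin.

Definition separableOver (F L : fieldType) (f : F -> L) (x : L) : Prop :=
  exists2 p : {poly F}, separable_poly p & root (map_poly f p) x.

Definition is_alg_closure (F : fieldType) (C : closedFieldType) (f : F -> C) :=
  forall x : C, algebraicOver f x.

Section SeparableClosed.

Lemma finite_subext (F C : fieldType) (f : {rmorphism F -> C}) x :
    algebraicOver f x ->
  exists (E : fieldExtType F) (j : {rmorphism E -> C}) (r : E),
    (forall c, j c%:A = f c) /\ j r = x.
Proof.
case=> p p0 px.
pose P n := `[< exists q : {poly F}, [/\ q != 0, root (map_poly f q) x & size q = n] >].
have exP : exists n, P n by exists (size p); apply/asboolP; exists p.
case: (ex_minnP exP) => n /asboolP[q [q0 qx sq]] minq.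
have irrq : irreducible_poly q.
  apply/(subfx_irreducibleP qx q0) => r rx r0; rewrite sq.
  by apply: minq; apply/asboolP; exists r.
exists (SubFieldExtType qx irrq), (@subfx_inj F C f x q : {rmorphism _ -> _}),
  (subfx_root f x q); split=> [c|].
  exact: (subfx_inj_base qx).
exact: (subfx_inj_root qx q0).
Qed.

Variables (F C : fieldType) (f : {rmorphism F -> C}).

Lemma separable_algebraic x : separableOver f x -> algebraicOver f x.
Proof. by case=> p /separable_poly_neq0 p0 px; exists p. Qed.

Lemma separable_in_ext (E : fieldExtType F) (j : {rmorphism E -> C}) (r : E) :
    (forall c, j c%:A = f c) ->
  separableOver f (j r) <-> separable_element 1%AS r.
Proof.
move=> jf.
have mapE p : map_poly j (map_poly (in_alg E) p) = map_poly f p.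
  by rewrite -map_poly_comp; apply: eq_map_poly => c /=; rewrite jf.
split=> [[p sp px]|/separable_elementP[q [q1 qr sq]]].
  apply/separable_elementP; exists (map_poly (in_alg E) p); split.
  - by apply/polyOver1P; exists p.
  - by rewrite -(fmorph_root j) mapE.
  - by rewrite separable_map.
have [p Dq] := polyOver1P q1; rewrite {}Dq in qr sq.
exists p; first by rewrite separable_map in sq.
by rewrite -mapE fmorph_root.
Qed.

Lemma separable_closed2 x y :
    separableOver f x -> separableOver f y ->
  separableOver f (x - y) /\ separableOver f (x / y).
Proof.
move=> sx sy.
have [E1 [j1 [r [j1f j1r]]]] := finite_subext (separable_algebraic sx).
have /finite_subext[E2 [j2 [s [j2f j2s]]]] : algebraicOver j1 y.
  case: (separable_algebraic sy) => p p0 py.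
  exists (map_poly (in_alg E1) p); first by rewrite map_poly_eq0.
  suff -> : map_poly j1 (map_poly (in_alg E1) p) = map_poly f p by [].
  by rewrite -map_poly_comp; apply: eq_map_poly => c /=; rewrite j1f.
pose E : fieldExtType F := baseFieldType E2.
pose j : {rmorphism E -> C} := j2.
have jf c : j c%:A = f c by rewrite -j1f -j2f.
have jx : j (r%:A : E2) = x by rewrite -j1r -j2f.
have jy : j s = y by [].
set x0 : E := (r%:A : E2) in jx; set y0 : E := s in jy.
have sx0 : separable_element 1%AS x0 by apply/(separable_in_ext _ jf); rewrite jx.
have sy0 : separable_element 1%AS y0 by apply/(separable_in_ext _ jf); rewrite jy.
have sep_xy u : u \in <<<<1; y0>>; x0>>%VS -> separable_element 1%AS u.
  have sepKy_x := separable_elementS (subv_adjoin 1%AS y0) sx0.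
  have [z defKz] := Primitive_Element_Theorem x0 sy0.
  rewrite defKz; apply/(adjoin_separableP (K := 1%AS)).
  apply: adjoin_separable sy0 (adjoin_separable sepKy_x _).
  by rewrite defKz base_separable ?memv_adjoin.
have x0in : x0 \in <<<<1; y0>>; x0>>%VS by apply: memv_adjoin.
have y0in : y0 \in <<<<1; y0>>; x0>>%VS.
  by apply: subvP_adjoin; apply: memv_adjoin.
split.
  have -> : x - y = j (x0 - y0) by rewrite rmorphB jx jy.
  by apply/(separable_in_ext _ jf)/sep_xy; rewrite rpredB.
have -> : x / y = j (x0 / y0) by rewrite fmorph_div jx jy.
by apply/(separable_in_ext _ jf)/sep_xy; rewrite rpred_div.
Qed.

Lemma separable_base c : separableOver f (f c).
Proof.
exists ('X - c%:P); first by rewrite unlock !derivCE coprimep1.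
by rewrite map_polyXsubC root_XsubC.
Qed.

End SeparableClosed.

Section SepClosure.
Variables (F C : fieldType) (f : {rmorphism F -> C}).

Definition sepcl_pred : {pred C} := fun x => `[< separableOver f x >].

Fact sepcl_divring : divring_closed sepcl_pred.
Proof.
split=> [|x y /asboolP sx /asboolP sy|x y /asboolP sx /asboolP sy];
  apply/asboolP; last 2 first.
- by have [] := separable_closed2 sx sy.
- by have [] := separable_closed2 sx sy.
by rewrite -(rmorph1 f); apply: separable_base.
Qed.

HB.instance Definition _ := GRing.isDivringClosed.Build C sepcl_pred
  sepcl_divring.

Fact sepcl_base c : f c \in sepcl_pred.
Proof. exact/asboolP/separable_base. Qed.

Definition sepcl : fieldType := subfield_of sepcl_pred.
Definition sepcl_incl : {rmorphism sepcl -> C} := subfield_incl sepcl_pred.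
Definition to_sepcl : {rmorphism F -> sepcl} := corestr sepcl_base.

Definition is_gal (s : {rmorphism sepcl -> sepcl}) : Prop :=
  bijective s /\ forall c, s (to_sepcl c) = to_sepcl c.

Variables (G : ozmodType) (w : valuation C G).

(* g = kras(x, F) = max { w (t x - s x) | s, t in Gal F, t x <> s x } *)
Definition is_kras (x : sepcl) (g : option G) : Prop :=
  (exists s t, [/\ is_gal s, is_gal t, t x <> s x
                 & g = w (sepcl_incl (t x - s x))])
  /\ (forall s t, is_gal s -> is_gal t -> t x <> s x ->
        vle (w (sepcl_incl (t x - s x))) g).

Definition in_decomposition_group (s : {rmorphism sepcl -> sepcl}) : Prop :=
  is_gal s /\ forall x, w (sepcl_incl (s x)) = w (sepcl_incl x).

(* The henselization of F inside (C, w), for C an algebraic closure of F. *)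
Definition in_henselization (x : C) : Prop :=
  exists2 y : sepcl, sepcl_incl y = x
    & forall s, in_decomposition_group s -> s y = y.

End SepClosure.

Section Homogeneous.
Variables (K L : fieldType) (f : {rmorphism K -> L}).
Variables (GK GL : ozmodType) (vK : valuation K GK) (vL : valuation L GL).

Definition unique_extension (E : fieldType) (g : {rmorphism K -> E}) : Prop :=
  forall (G1 G2 : ozmodType) (w1 : valuation E G1) (w2 : valuation E G2),
    val_extends g vK w1 -> val_extends g vK w2 -> val_equiv w1 w2.

(* In the last clause Kt is an algebraic closure of K that contains K(a), and w
   extends v from K(a) to Kt, so that v a and kras(a, K) are compared in the
   value group of w. The extensions of v from K to Kt being conjugate under
   Gal K, the choice of Kt and w does not matter. *)
Definition strongly_homogeneous (a : L) : Prop :=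
  [/\ separableOver f a,
      (forall c, f c <> a),
      unique_extension (to_adjoin f a)
    & exists (Kt : closedFieldType) (j : {rmorphism adjoin f a -> Kt})
             (G : ozmodType) (w : valuation Kt G)
             (a' : sepcl (j \o to_adjoin f a)),
        [/\ is_alg_closure (j \o to_adjoin f a),
            val_extends j (restrict_val (adjoin_incl f a) vL) w,
            sepcl_incl (j \o to_adjoin f a) a' = j (adjoin_elt f a)
          & is_kras w a' (w (j (adjoin_elt f a)))]].

Definition homogeneous_approximation (a b : L) : Prop :=
  exists d : K, [/\ strongly_homogeneous (a - f d),
                    vlt (vL (b - f d)) (vL (b - a))
                  & vle (vL b) (vL (b - f d))].

End Homogeneous.

(* Main.v *)
Require Import Defs.
From HB Require Import structures.
From mathcomp Require Import all_boot all_order all_algebra all_field.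
From mathcomp Require Import boolp classical_sets.

(* Put x = a - d, with conjugates r over K. An automorphism s in the
   decomposition group fixes b and preserves v, so
   v (s a - a) >= v (b - a) > v (b - d) >= v x. It remains to show that
   v (x - r) <= v x for each conjugate r <> x, where v is the given valuation of
   the algebraic closure of K(b). The Krasner constant gives this for some
   extension of v to the algebraic closure of K. Instead of comparing the two
   extensions by an isomorphism, one reads off from the Krasner bound that
   v (q x) <= (deg q) (v x), where (X - x) q is the minimal polynomial of x;
   this involves elements of K(x) only. In the closure of K(b), each factor x - r
   of q x has value at least v x, since the uniqueness of the extension to K(x)
   gives v r = v x; so no factor can have a larger value. *)

Set Implicit Arguments.
Unset Strict Implicit.
Unset Printing Implicit Defensive.

Import Order.TTheory GRing.Theory.
Local Open Scope ring_scope.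

(** * Minimal polynomials *)

Lemma algebraic_minpoly {F E : fieldType} {f : {rmorphism F -> E}} {x : E} :
    algebraicOver f x ->
  exists p : {poly F}, [/\ p \is monic, irreducible_poly p, root (map_poly f p) x
    & forall q, root (map_poly f q) x -> p %| q].
Proof.
case=> p0 p00 p0x.
pose P n :=
  `[< exists q : {poly F}, [/\ q != 0, root (map_poly f q) x & size q = n] >].
have exP : exists n, P n by exists (size p0); apply/asboolP; exists p0.
case: (ex_minnP exP) => n /asboolP[q [q0 qx sq]] minq.
have irrq : irreducible_poly q.
  apply/(subfx_irreducibleP qx q0) => r rx r0; rewrite sq.
  by apply: minq; apply/asboolP; exists r.
have lq : (lead_coef q)^-1 != 0 by rewrite invr_eq0 lead_coef_eq0.
have dvq r : root (map_poly f r) x -> q %| r.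
  (* If [q] does not divide [r], irreducibility makes them coprime, and the Bezout identity
     evaluated at [x] reads 0 = 1. *)
  move=> rx; apply: contraT => /negPf nqr.
  have /Bezout_eq1_coprimepP[[u v] /= uv] : coprimep q r.
    by rewrite irreducible_poly_coprime // nqr.
  have := congr1 (fun s => (map_poly f s).[x]) uv.
  rewrite rmorphD !rmorphM rmorph1 /= !hornerE (rootP qx) (rootP rx) !mulr0 addr0.
  by move/eqP; rewrite eq_sym oner_eq0.
exists ((lead_coef q)^-1 *: q); split.
- by rewrite monicE lead_coefZ mulVf // lead_coef_eq0.
- split=> [|s ss sd]; first by rewrite size_scale //; case: irrq.
  by rewrite (eqp_rtrans (eqp_scale _ lq)); apply: irrq.2 => //; rewrite dvdpZr in sd.
- by rewrite map_polyZ rootZ // fmorph_eq0.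
- by move=> r rx; rewrite dvdpZl // dvq.
Qed.

(** * Extending homomorphisms into an algebraically closed field *)

Section HomGraph.
Variables (F C1 C2 : fieldType) (f1 : {rmorphism F -> C1}) (f2 : {rmorphism F -> C2}).

(** Partial homomorphisms over [F], encoded as relations so that Zorn's lemma applies to inclusion
    of sets. Since differences stay in [A], the last clause makes the relation single-valued. *)
Definition hom_graph (A : set (C1 * C2)) :=
  [/\ forall c, A (f1 c, f2 c),
      forall u v u' v', A (u, v) -> A (u', v') -> A (u - u', v - v'),
      forall u v u' v', A (u, v) -> A (u', v') -> A (u / u', v / v')
    & forall v, A (0, v) -> v = 0].

Lemma hom_graph_functional A u v v' :
  hom_graph A -> A (u, v) -> A (u, v') -> v = v'.
Proof.
case=> _ AB _ A0 Av Av'; apply/eqP; rewrite -subr_eq0; apply/eqP/A0.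
by have := AB _ _ _ _ Av Av'; rewrite subrr.
Qed.

Lemma hom_graph_morphism A (E : fieldType) (e : {rmorphism E -> C1}) :
    hom_graph A -> (forall c, exists v, A (e c, v)) ->
  exists g : {rmorphism E -> C2}, forall c, A (e c, g c).
Proof.
move=> hA /choice[g Ag]; have [Af AB AD _] := hA.
have gB : zmod_morphism g.
  move=> x y; apply: (hom_graph_functional (u := e (x - y)) hA) => //.
  by rewrite rmorphB; apply: AB.
have A1 : A (1, 1) by have := Af 1; rewrite !rmorph1.
have gM : monoid_morphism g.
  split=> [|x y].
    by apply: (hom_graph_functional (u := e 1) hA) => //; rewrite rmorph1.
  apply: (hom_graph_functional (u := e (x * y)) hA) => //; rewrite rmorphM.
  (* Products are obtained from quotients, as x y = x / (1 / y). *)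
  have := AD _ _ _ _ (Ag x) (AD _ _ _ _ A1 (Ag y)).
  by rewrite !div1r !invrK.
pose gm := GRing.isZmodMorphism.Build _ _ g gB.
pose gn := GRing.isMonoidMorphism.Build _ _ g gM.
pose G : {rmorphism E -> C2} := HB.pack g gm gn.
by exists G.
Qed.

Section Domain.
Variables (A : set (C1 * C2)) (hA : hom_graph A).

Definition graph_dom_pred : {pred C1} := fun u => `[< exists v, A (u, v) >].

Fact graph_dom_divring : divring_closed graph_dom_pred.
Proof.
have [Af AB AD _] := hA.
split=> [|x y /asboolP[u xu] /asboolP[v yv]|x y /asboolP[u xu] /asboolP[v yv]];
  apply/asboolP.
- by exists (f2 1); rewrite -(rmorph1 f1).
- by exists (u - v); apply: AB.
- by exists (u / v); apply: AD.
Qed.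

HB.instance Definition _ := GRing.isDivringClosed.Build C1 graph_dom_pred
  graph_dom_divring.

Fact graph_dom_base c : f1 c \in graph_dom_pred.
Proof. by have [Af _ _ _] := hA; apply/asboolP; exists (f2 c). Qed.

(** With its domain made into a field [E], a partial map becomes a new base embedding, over which a
    further element can be adjoined. *)
Lemma hom_graph_dom : exists (E : fieldType) (h : {rmorphism F -> E})
    (e : {rmorphism E -> C1}) (g : {rmorphism E -> C2}),
  [/\ forall c, e (h c) = f1 c, forall c, A (e c, g c)
    & forall u v, A (u, v) -> exists2 c, e c = u & g c = v].
Proof.
pose e := subfield_incl graph_dom_pred.
have eA c : exists v, A (e c, v) by case: c => u /= /asboolP.
have [g Ag] := hom_graph_morphism hA eA.
exists (subfield_of graph_dom_pred), (corestr graph_dom_base), e, g.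
split=> // u v Auv.
have uS : u \in graph_dom_pred by apply/asboolP; exists v.
exists (Subfield uS) => //.
by apply: (hom_graph_functional (u := u) hA) => //; apply: (Ag (Subfield uS)).
Qed.

End Domain.

(** Evaluation at [x] and at [y] have the same kernel: one inclusion is assumed, and the other is
    Bezout's identity with the minimal polynomial of [x]. Hence q(x) / r(x) can be sent to q(y) /
    r(y). *)
Lemma hom_graph_adjoin x y : algebraicOver f1 x ->
    (forall p, root (map_poly f1 p) x -> root (map_poly f2 p) y) ->
  exists2 A, hom_graph A & A (x, y).
Proof.
move=> /algebraic_minpoly[p [_ irrp px pmin]] xy.
have xyN q : ~~ root (map_poly f1 q) x -> ~~ root (map_poly f2 q) y.
  move=> nqx; have : coprimep p q.
    rewrite irreducible_poly_coprime //; apply: contra nqx => /dvdpP[r ->].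
    by rewrite rmorphM rootM px orbT.
  case/Bezout_eq1_coprimepP=> -[u v] /= uv; apply/negP => qy.
  have := congr1 (fun s => (map_poly f2 s).[y]) uv.
  rewrite rmorphD !rmorphM rmorph1 /= !hornerE (rootP qy) (rootP (xy _ px)) !mulr0 addr0.
  by move/eqP; rewrite eq_sym oner_eq0.
pose e1 q := (map_poly f1 q).[x]; pose e2 q := (map_poly f2 q).[y].
have E0 q : (e2 q == 0) = (e1 q == 0).
  by apply/idP/idP; [apply: contraTT; apply: xyN | apply: xy].
exists (fun uv : C1 * C2 => exists q r,
    [/\ e1 r != 0, uv.1 = e1 q / e1 r & uv.2 = e2 q / e2 r]); last first.
  by exists 'X, 1; rewrite /e1 /e2 !rmorph1 !map_polyX !hornerE !divr1 oner_neq0.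
have e1M q r : e1 (q * r) = e1 q * e1 r by rewrite /e1 rmorphM hornerM.
have e2M q r : e2 (q * r) = e2 q * e2 r by rewrite /e2 rmorphM hornerM.
have e1B q r : e1 (q - r) = e1 q - e1 r by rewrite /e1 rmorphB !hornerE.
have e2B q r : e2 (q - r) = e2 q - e2 r by rewrite /e2 rmorphB !hornerE.
split=> [c|_ _ _ _ [q [r [r0 /= -> ->]]] [s [t [t0 /= -> ->]]]
          |_ _ _ _ [q [r [r0 /= -> ->]]] [s [t [t0 /= -> ->]]]
          |_ [q [r [r0 /= /esym/eqP + ->]]]].
- exists c%:P, 1; rewrite /e1 /e2 !rmorph1 !map_polyC !hornerE !divr1.
  by rewrite oner_neq0.
- have r20 : e2 r != 0 by rewrite E0.
  have t20 : e2 t != 0 by rewrite E0.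
  exists (q * t - s * r), (r * t).
  by rewrite e1B e2B !e1M !e2M mulf_neq0 // -!mulNr !addf_div.
(* Division by zero returns 0, and [e2 s] vanishes together with [e1 s], so this case only needs the
   pair (0, 0). *)
- have [s0|s0] := eqVneq (e1 s) 0.
    exists 0, 1; have /eqP s20 : e2 s == 0 by rewrite E0 s0.
    rewrite s0 s20 !mul0r !invr0 !mulr0 /e1 /e2 !rmorph0 !rmorph1 !hornerE.
    by rewrite oner_neq0.
  exists (q * t), (r * s); rewrite !e1M !e2M mulf_neq0 //.
  by rewrite !invf_div !mulf_div.
rewrite mulf_eq0 invr_eq0 (negPf r0) orbF -E0 => /eqP ->.
by rewrite mul0r.
Qed.

Lemma hom_graph_bigcup (U : set (set (C1 * C2))) :
    (forall A, U A -> hom_graph A) -> total_on U subset -> (U !=set0)%classic ->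
  hom_graph (\bigcup_(A in U) A)%classic.
Proof.
move=> Uh Ut [A0 UA0].
have U2 uv uv' : (\bigcup_(A in U) A)%classic uv -> (\bigcup_(A in U) A)%classic uv' ->
    exists A, [/\ U A, A uv & A uv'].
  move=> [A UA Auv] [B UB Buv'].
  by have [AB|BA] := Ut _ _ UA UB; [exists B|exists A]; split=> //; [apply: AB|apply: BA].
split=> [c|u v u' v' /U2 H /H[A [UA Auv Auv']]|u v u' v' /U2 H /H[A [UA Auv Auv']]
          |v [A UA Av]].
- by exists A0 => //; have [] := Uh _ UA0.
- by exists A => //; have [_ + _ _] := Uh _ UA; apply.
- by exists A => //; have [_ _ + _] := Uh _ UA; apply.
- by have [_ _ _] := Uh _ UA; apply.
Qed.

End HomGraph.

(** A maximal partial homomorphism sending [x] to [y] is total: an element [z] outside its domain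
    has a minimal polynomial over that domain, whose image in [C2] has a root to which [z] can be
    sent. *)
Lemma closed_extend_morphism (F C1 : fieldType) (C2 : closedFieldType)
    (f1 : {rmorphism F -> C1}) (f2 : {rmorphism F -> C2}) x y :
    (forall z, algebraicOver f1 z) ->
    (forall p, root (map_poly f1 p) x -> root (map_poly f2 p) y) ->
  exists g : {rmorphism C1 -> C2}, (forall c, g (f1 c) = f2 c) /\ g x = y.
Proof.
move=> algC xy; have [A0 hA0 A0x] := hom_graph_adjoin (algC x) xy.
pose P A := A = set0 \/ hom_graph f1 f2 A /\ A (x, y).
have [|A [PA maxA]] := @Zorn_bigcup _ P.
  move=> U UP Ut.
  have [[B [UB B0]]|noB] := pselect (exists B, U B /\ (B !=set0)%classic); last first.
    left; apply/seteqP; split=> // uv [B UB Buv].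
    by case: noB; exists B; split=> //; exists uv.
  have eU : (\bigcup_(A in U) A = \bigcup_(A in [set A | U A /\ A !=set0]%classic) A)%classic.
    apply/seteqP; split=> uv [D]; first by move=> UD Duv; exists D => //; split=> //; exists uv.
    by case=> UD _ Duv; exists D.
  have gP D : U D -> (D !=set0)%classic -> hom_graph f1 f2 D /\ D (x, y).
    by move=> /UP[->|//] /set0P; rewrite eqxx.
  right; rewrite eU; split; last by exists B => //; have [] := gP B UB B0.
  apply: hom_graph_bigcup; last by exists B.
    by move=> D [UD D0]; have [] := gP D UD D0.
  by move=> D D' [UD _] [UD' _]; apply: Ut.
(* A maximal set is not empty, as [A0] would lie strictly above it. *)
have {PA} [hA Ax] : hom_graph f1 f2 A /\ A (x, y).
  case: PA => // eA; case: (maxA A0); last by right.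
  by rewrite eA; split=> // A0s; have := A0s _ A0x.
have [E [h [e [g [eh Ag Ae]]]]] := hom_graph_dom hA.
have [Atot|/existsNP[z nAz]] := pselect (forall z, exists v, A (z, v)).
  have [phi Aphi] := hom_graph_morphism (e := idfun) hA Atot.
  exists phi; have [Af _ _ _] := hA; split=> [c|].
    by apply: (hom_graph_functional hA (Aphi (f1 c))); apply: Af.
  exact: (hom_graph_functional hA (Aphi x)).
have [p [_ irrp pz pmin]] : exists p : {poly E}, [/\ p \is monic,
    irreducible_poly p, root (map_poly e p) z
    & forall q, root (map_poly e q) z -> p %| q].
  apply: algebraic_minpoly; have [q q0 qz] := algC z.
  exists (map_poly h q); first by rewrite map_poly_eq0.
  by rewrite -map_poly_comp (@eq_map_poly _ _ _ f1).
have /closed_rootP[z' pz'] : size (map_poly g p) != 1%N.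
  by rewrite size_map_poly neq_ltn irrp.1 orbT.
have [||B hB Bz] := @hom_graph_adjoin _ _ _ e g z z'.
- by exists p => //; apply: irredp_neq0.
- by move=> q /pmin/dvdpP[r ->]; rewrite rmorphM rootM pz' orbT.
have AB : (A `<=` B)%classic.
  by move=> [u v] /Ae[c <- <-]; have [] := hB.
case: (maxA B).
  by split=> // BA; apply: nAz; exists z'; apply: BA.
right; split; last exact: AB.
by have [_ BB BD B0] := hB; split=> // c; apply: AB; have [] := hA.
Qed.

(** * Galois automorphisms with a prescribed conjugate *)

Lemma sepcl_gal_conjugate (F : fieldType) (C : closedFieldType)
    (f : {rmorphism F -> C}) (x : sepcl f) (y : C) :
    is_alg_closure f ->
    (forall p, root (map_poly f p) (sepcl_incl f x) -> root (map_poly f p) y) ->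
  exists s, is_gal s /\ sepcl_incl f (s x) = y.
Proof.
move=> algC xy; have [g [gf gx]] := closed_extend_morphism algC xy.
have groot p z : root (map_poly f p) z -> root (map_poly f p) (g z).
  have -> : map_poly f p = map_poly g (map_poly f p).
    by rewrite -map_poly_comp; apply: eq_map_poly => c /=; rewrite gf.
  by rewrite fmorph_root -map_poly_comp (@eq_map_poly _ _ _ f).
have gsep z : (g \o sepcl_incl f) z \in sepcl_pred f.
  case: z => z /= /asboolP[p sp pz]; apply/asboolP; exists p => //.
  exact: groot.
exists (corestr gsep); split; last by [].
split; last by move=> c; apply: val_inj => /=; apply: gf.
(* The injective map [g] sends the finite set of roots of [p] in [C] into itself, hence permutes
   it. *)
have surj z : exists t, corestr gsep t = z.
  case: z => z zS; have /asboolP[p sp pz] := zS.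
  have [rs] := closed_field_poly_normal (map_poly f p).
  have lp0 : lead_coef (map_poly f p) != 0.
    by rewrite lead_coef_eq0 map_poly_eq0 separable_poly_neq0.
  move=> Dp; have rootE u : root (map_poly f p) u = (u \in undup rs).
    by rewrite Dp rootZ // root_prod_XsubC mem_undup.
  have sub : {subset map g (undup rs) <= undup rs}.
    by move=> _ /mapP[u + ->]; rewrite -!rootE; apply: groot.
  have umap : uniq (map g (undup rs)).
    by rewrite map_inj_uniq ?undup_uniq //; apply: fmorph_inj.
  have [|_ eqr] := uniq_min_size umap sub; first by rewrite size_map.
  have : z \in map g (undup rs) by rewrite eqr -rootE.
  case/mapP=> u; rewrite -rootE => pu Dz.
  have uS : u \in sepcl_pred f by apply/asboolP; exists p.
  by exists (Subfield uS); apply: val_inj.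
have [t tK] := choice surj.
exists t => // z; apply: (fmorph_inj (corestr gsep)); exact: tK.
Qed.

(** * Inequalities between values of products *)

Section Valuations.
Variables (F : fieldType) (G : ozmodType) (w : valuation F G).
Implicit Types x y z : F.

Lemma vle_trans (b a c : option G) : vle a b -> vle b c -> vle a c.
Proof. by case: a b c => [a|] [b|] [c|] //=; apply: le_trans. Qed.

Lemma vle_total (a b : option G) : vle a b || vle b a.
Proof. by case: a b => [a|] [b|] //=; apply: ozmod_total. Qed.

Lemma val_leMr z x y : vle (w x) (w y) -> vle (w (x * z)) (w (y * z)).
Proof.
rewrite !val_mul; case: (w x) (w y) (w z) => [a|] [b|] [c|] //=.
exact: ozmod_leD2r.
Qed.

Lemma val_leMl z x y : vle (w x) (w y) -> vle (w (z * x)) (w (z * y)).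
Proof. by rewrite ![z * _]mulrC; apply: val_leMr. Qed.

Lemma val_leMr_inv z x y :
  z != 0 -> vle (w (x * z)) (w (y * z)) -> vle (w x) (w y).
Proof. by move=> z0 /(val_leMr z^-1); rewrite !mulfK. Qed.

Lemma val_leD x y z :
  vle (w x) (w y) -> vle (w x) (w z) -> vle (w x) (w (y + z)).
Proof.
by move=> xy xz; case/orP: (val_add w y z); apply: vle_trans.
Qed.

Lemma val_leN x : vle (w x) (w (- x)).
Proof.
have: vle (w 1) (w (-1)).
  (* If instead v(-1) <= v(1), multiplication by -1 turns this into the wanted inequality. *)
  case/orP: (vle_total (w 1) (w (-1))) => // /(val_leMr (-1)).
  by rewrite mulrNN mulr1 mul1r.
by move/(val_leMr x); rewrite mulN1r mul1r.
Qed.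

Lemma val_opp_le x : vle (w (- x)) (w x).
Proof. by have := val_leN (- x); rewrite opprK. Qed.

Lemma val_leB x y z :
  vle (w x) (w y) -> vle (w x) (w z) -> vle (w x) (w (y - z)).
Proof. by move=> xy xz; apply: val_leD => //; apply: vle_trans (val_leN _). Qed.

Lemma val_le_prod (T : eqType) (s : seq T) (X Y : T -> F) :
    {in s, forall i, vle (w (X i)) (w (Y i))} ->
  vle (w (\prod_(i <- s) X i)) (w (\prod_(i <- s) Y i)).
Proof.
elim: s => [|i s IHs] XY; first by rewrite !big_nil -[vle _ _]orbb vle_total.
rewrite !big_cons; apply: vle_trans (val_leMl _ (IHs _)); last first.
  by move=> k ks; apply: XY; rewrite inE ks orbT.
by apply/val_leMr/XY/mem_head.
Qed.

(** Factorwise inequalities in one direction and an inequality of the products in the other force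
    equality at every factor: all other factors can be cancelled, having finite values. *)
Lemma val_prod_le_inv (T : eqType) (s : seq T) (X Y : T -> F) :
    {in s, forall i, X i != 0} -> {in s, forall i, Y i != 0} ->
    {in s, forall i, vle (w (Y i)) (w (X i))} ->
    vle (w (\prod_(i <- s) X i)) (w (\prod_(i <- s) Y i)) ->
  {in s, forall i, vle (w (X i)) (w (Y i))}.
Proof.
elim: s => [|i s IHs] // X0 Y0 YX.
have X0s : {in s, forall k, X k != 0} by move=> k ks; apply: X0; rewrite inE ks orbT.
have Y0s : {in s, forall k, Y k != 0} by move=> k ks; apply: Y0; rewrite inE ks orbT.
have YXs : {in s, forall k, vle (w (Y k)) (w (X k))}.
  by move=> k ks; apply: YX; rewrite inE ks orbT.
rewrite !big_cons => le_prod k; rewrite inE => /predU1P[->{k}|ks].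
  apply: (@val_leMr_inv (\prod_(k <- s) Y k)).
    by rewrite prodf_seq_neq0; apply/allP => k ks; apply: Y0s.
  by apply: vle_trans le_prod; apply/val_leMl/val_le_prod.
apply: IHs => //; apply: (@val_leMr_inv (Y i)); first exact/Y0/mem_head.
rewrite [_ * Y i]mulrC [X in vle _ (w X)]mulrC.
by apply: vle_trans le_prod; apply/val_leMr/YX/mem_head.
Qed.

(** The value group has no torsion; this is [val_prod_le_inv] with [n] equal factors. *)
Lemma val_leX_inv n x y : (0 < n)%N -> x != 0 -> y != 0 ->
  vle (w (x ^+ n)) (w (y ^+ n)) -> vle (w x) (w y).
Proof.
case: n => // n _ x0 y0 xyn; case/orP: (vle_total (w x) (w y)) => // yx.
apply: (@val_prod_le_inv _ (index_enum 'I_n.+1) (fun=> x) (fun=> y) _ _ _ _ ord0) => //.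
by rewrite !prodr_const card_ord.
Qed.

End Valuations.

Lemma closed_monic_map_normal (E : fieldType) (C : closedFieldType)
    (j : {rmorphism E -> C}) (q : {poly E}) :
  q \is monic ->
  exists2 s : seq C, map_poly j q = \prod_(r <- s) ('X - r%:P) & size s = (size q).-1.
Proof.
move=> mq; have [s] := closed_field_poly_normal (map_poly j q).
rewrite (monicP _) ?map_monic // scale1r => Ds; exists s => //.
by rewrite -(size_map_poly j) Ds size_prod_XsubC.
Qed.

(** * Values of conjugates in two algebraically closed fields *)

Section Conjugates.
Variables (K E : fieldType) (f : {rmorphism K -> E}) (x : E).

(** Quantifying over all polynomials avoids choosing a minimal one and matches the hypothesis of
    [closed_extend_morphism]. *)
Definition conjugate_in (C : fieldType) (j : {rmorphism E -> C}) (r : C) :=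
  forall p, root (map_poly f p) x -> root (map_poly (j \o f) p) r.

Variables (GK GE : ozmodType) (v : valuation K GK) (vE : valuation E GE).
Hypotheses (fv : val_extends f v vE) (sepx : separableOver f x).
Hypotheses (x0 : x != 0) (uniq_ext : unique_extension v f).
Variables (C1 C2 : closedFieldType).
Variables (j1 : {rmorphism E -> C1}) (j2 : {rmorphism E -> C2}).
Variables (G1 G2 : ozmodType) (w1 : valuation C1 G1) (w2 : valuation C2 G2).
Hypotheses (algC1 : is_alg_closure (j1 \o f)).
Hypotheses (j1v : val_extends j1 vE w1) (j2v : val_extends j2 vE w2).

(* By uniqueness, the valuations of K(x) obtained by sending x to its various
   conjugates r compare r^n with the norm N of x in the same way, for n the
   degree of x; as N^n is the product of all r^n, all of them have the value
   of N. *)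
Lemma val_conjugate_le r : conjugate_in j2 r -> vle (w2 (j2 x)) (w2 r).
Proof.
have [p [mp _ px pmin]] := algebraic_minpoly (separable_algebraic sepx).
have [s Ds ss] : exists2 s : seq C2,
    map_poly (j2 \o f) p = \prod_(r <- s) ('X - r%:P) & size s = (size p).-1.
  have [|s Ds ss] := @closed_monic_map_normal _ _ j2 (map_poly f p); first by rewrite map_monic.
  by exists s; rewrite ?map_poly_comp // ss size_map_poly.
(* The constant coefficient of the minimal polynomial is the norm of [x] up to sign, hence the
   product of the [- r]. The signs do not affect values. *)
pose n := size s; pose N := j2 (f p.[0]).
have DN : N = \prod_(r <- s) - r.
  rewrite /N -[j2 _]/((j2 \o f) _) -horner_map rmorph0 Ds horner_prod.
  by apply: eq_bigr => t _; rewrite !hornerE.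
have sP t : t \in s -> conjugate_in j2 t.
  rewrite -root_prod_XsubC -Ds => pt q /pmin/dvdpP[u ->].
  by rewrite rmorphM rootM pt orbT.
have conj_s t : conjugate_in j2 t -> t \in s.
  by move=> /(_ _ px); rewrite Ds root_prod_XsubC.
have xs : j2 x \in s by apply: conj_s => q; rewrite map_poly_comp fmorph_root.
have n0 : (0 < n)%N by rewrite /n; case: (s) xs.
have conjP t : t \in s -> exists h : {rmorphism E -> C2},
    [/\ h x = t, forall c, h (f c) = j2 (f c)
      & val_equiv (restrict_val h w2) (restrict_val j2 w2)].
  (* [C2] need not be algebraic over [K], so the homomorphism is built from [C1] to [C2]. Composed
     with [j1] it sends [x] to [t], and pulling [w2] back along it gives a second extension of [v]
     to K(x). *)
  move=> ts; have [q|g [gf gx]] := @closed_extend_morphism _ _ _ (j1 \o f) (j2 \o f) (j1 x) t algC1.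
    by rewrite map_poly_comp fmorph_root; apply: sP.
  exists (g \o j1); split=> //; apply: uniq_ext => c d; rewrite fv j2v //=.
  by have /= := gf c; have /= := gf d => -> ->.
have s0 t : t \in s -> t != 0.
  by case/conjP=> h [<- _ _]; rewrite fmorph_eq0.
have sN0 t : t \in s -> - t != 0 by rewrite oppr_eq0; apply: s0.
have N0 : N != 0 by rewrite DN prodf_seq_neq0; apply/allP => t /sN0.
have sE t : t \in s ->
    (vle (w2 ((- t) ^+ n)) (w2 N) = vle (w2 ((- j2 x) ^+ n)) (w2 N))
  * (vle (w2 N) (w2 ((- t) ^+ n)) = vle (w2 N) (w2 ((- j2 x) ^+ n))).
  case/conjP=> h [<- hf hE].
  have := hE ((- x) ^+ n) (f p.[0]); have := hE (f p.[0]) ((- x) ^+ n).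
  by rewrite /= hf !rmorphXn !rmorphN => -> ->.
have prodE : \prod_(t <- s) (- t) ^+ n = \prod_(t <- s) N.
  by rewrite prodrXl -DN big_const_seq count_predT -Monoid.iteropE.
have sX0 : {in s, forall t, (- t) ^+ n != 0} by move=> t /sN0; apply: expf_neq0.
have refl (y : C2) : vle (w2 y) (w2 y) by rewrite -[vle _ _]orbb vle_total.
move/conj_s=> rs; apply: vle_trans (val_leN _ _) _.
apply: vle_trans (val_opp_le w2 r).
apply: (@val_leX_inv _ _ _ n) => //; try exact: sN0.
(* Whichever inequality holds for [x] holds for all conjugates; since the two products in [prodE]
   agree, it is an equality at each of them. *)
case/orP: (vle_total (w2 ((- j2 x) ^+ n)) (w2 N)) => xN.
  apply: vle_trans (xN) _.
  apply: (@val_prod_le_inv _ _ w2 _ s (fun=> N) (fun t => (- t) ^+ n) _ _ _ _ r) => //.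
    by move=> t /sE[-> _]; apply: xN.
  by rewrite prodE.
apply: (@vle_trans _ (w2 N)).
  apply: (@val_prod_le_inv _ _ w2 _ s (fun t => (- t) ^+ n) (fun=> N) _ _ _ _ (j2 x)) => //.
    by move=> t /sE[_ ->]; apply: xN.
  by rewrite prodE.
by rewrite (sE r rs).2.
Qed.

(* With p = (X - x) q the minimal polynomial of x, the bounds in C1 multiply to
   v (q x) <= (deg q) (v x), a statement over K(x) that carries over to C2,
   where each factor of q x has value at least v x. *)
Lemma val_sub_conjugate_transfer :
    (forall r, conjugate_in j1 r -> r != j1 x ->
       vle (w1 (j1 x - r)) (w1 (j1 x))) ->
  forall r, conjugate_in j2 r -> r != j2 x ->
    vle (w2 (j2 x - r)) (w2 (j2 x)).
Proof.
move=> kras1 r conj_r r_x.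
have [p [mp _ px pmin]] := algebraic_minpoly (separable_algebraic sepx).
have sepp : separable_poly p by have [q sq /pmin/dvdp_separable] := sepx; apply.
have [q Dp] := factor_theorem _ _ px.
have mq : q \is monic by rewrite -(monicMr _ (monicXsubC x)) -Dp map_monic.
(* By separability [x] is a simple root of [p], so [q] has only the other conjugates as roots. *)
have qx : ~~ root q x.
  have : separable_poly (map_poly f p) by rewrite separable_map.
  by rewrite Dp separable_mul coprimep_XsubC => /and3P[].
have root_q (C : closedFieldType) (j : {rmorphism E -> C}) t :
    root (map_poly j q) t -> conjugate_in j t /\ t != j x.
  move=> qt; split=> [u /pmin/dvdpP[u' ->]|].
    by rewrite rmorphM rootM /= [map_poly _ p]map_poly_comp Dp rmorphM rootM qt orbT.
  by apply: contraNneq qx => Dt; rewrite Dt fmorph_root in qt.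
have [s1 Ds1 ss1] := closed_monic_map_normal j1 mq.
have [s2 Ds2 ss2] := closed_monic_map_normal j2 mq.
have hornq (C : closedFieldType) (j : {rmorphism E -> C}) s :
    map_poly j q = \prod_(t <- s) ('X - t%:P) ->
    j q.[x] = \prod_(t <- s) (j x - t).
  move=> Dq; rewrite -horner_map Dq horner_prod.
  by apply: eq_bigr => t _; rewrite !hornerE.
have expE (C : closedFieldType) (s : seq C) (y : C) :
    \prod_(t <- s) y = y ^+ size s.
  by rewrite big_const_seq count_predT -Monoid.iteropE.
have s2P t : t \in s2 -> conjugate_in j2 t /\ t != j2 x.
  by rewrite -root_prod_XsubC -Ds2 => /root_q.
have rs2 : r \in s2.
  have := conj_r _ px; rewrite map_poly_comp Dp rmorphM rootM /= Ds2 root_prod_XsubC.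
  by rewrite map_polyXsubC root_XsubC (negPf r_x) orbF.
apply: (@val_prod_le_inv _ _ w2 _ s2 (fun t => j2 x - t) (fun=> j2 x) _ _ _ _ r) => //.
- by move=> t /s2P[_]; rewrite subr_eq0 eq_sym.
- by move=> t _; rewrite fmorph_eq0.
- move=> t /s2P[/val_conjugate_le xt _]; apply: val_leB => //.
  by rewrite -[vle _ _]orbb vle_total.
(* Both lists of roots have length deg [q], so the power of [x] has the same exponent on either
   side. *)
rewrite -(hornq _ _ _ Ds2) expE ss2 -ss1 -rmorphXn.
rewrite -[vle _ _]/(vle (restrict_val j2 w2 _) (restrict_val j2 w2 _)) -j2v j1v /=.
rewrite (hornq _ _ _ Ds1) rmorphXn -expE; apply: val_le_prod => t.
by rewrite -root_prod_XsubC -Ds1 => /root_q[]; apply: kras1.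
Qed.

End Conjugates.

(** * Automorphisms in the decomposition group fix a *)

Theorem lemma3p1
  (K L : fieldType) (iota : {rmorphism K -> L})
  (GK GL : ozmodType) (vK : valuation K GK) (vL : valuation L GL)
  (vKL : val_extends iota vK vL)
  (a b : L) (hab : homogeneous_approximation iota vK vL a b)
  (C : closedFieldType)
  (j : {rmorphism adjoin (adjoin_incl iota b) a -> C})
  (hC : is_alg_closure (j \o to_adjoin (adjoin_incl iota b) a))
  (G : ozmodType) (w : valuation C G)
  (hw : val_extends j
          (restrict_val (adjoin_incl (adjoin_incl iota b) a) vL) w) :
  in_henselization (j \o to_adjoin (adjoin_incl iota b) a) w
    (j (adjoin_elt (adjoin_incl iota b) a)).
Proof.
have [d [[sepad nKad uniq_ad homog] lt_ba _]] := hab.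
have [Kt [j1 [G1 [w1 [a' [algKt j1v Da' [_ kras]]]]]]] := homog.
set f := to_adjoin iota (a - iota d) in uniq_ad j1 algKt j1v a' Da' kras.
set x := adjoin_elt iota (a - iota d) in Da' kras.
set F2 := (j \o to_adjoin _ a).
pose k := to_adjoin iota b.
(* Inside [L], K(a - d) is contained in K(b)(a); following this inclusion by [j] embeds K(a - d)
   into [C]. *)
have E_N (c : adjoin iota (a - iota d)) :
    adjoin_incl iota (a - iota d) c \in adjoin_pred (adjoin_incl iota b) a.
  case: c => c /= /asboolP; apply.
  - exact: adjoin_divring.
  - by move=> e; apply: (adjoin_base (adjoin_incl iota b) a (k e)).
  - apply: rpredB; first exact: adjoin_gen.
    exact: (adjoin_base (adjoin_incl iota b) a (k d)).
pose j2 : {rmorphism adjoin iota (a - iota d) -> C} := j \o corestr E_N.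
have j2f : j2 \o f =1 F2 \o k.
  by move=> c; rewrite /j2 /F2 /=; congr (j _); apply: val_inj.
have j2x : j2 x = j (adjoin_elt (adjoin_incl iota b) a) - F2 (k d).
  by rewrite /j2 /F2 /= -rmorphB; congr (j _); apply: val_inj.
have [p sepp px] := sepad.
have px1 : root (map_poly f p) x.
  by rewrite -(fmorph_root (adjoin_incl iota (a - iota d))) -map_poly_comp.
have sepx : separableOver f x by exists p.
have x0 : x != 0.
  apply/eqP => /(congr1 (adjoin_incl _ _)) /esym.
  by rewrite rmorph0 -(rmorph0 iota); apply: nKad.
pose vE := restrict_val (adjoin_incl iota (a - iota d)) vL.
have fv : val_extends f vK vE by move=> c e; rewrite vKL.
have j2v : val_extends j2 vE w.
  by move=> c e; rewrite /= -[RHS]/(vle (restrict_val j w _) (restrict_val j w _)) -hw.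
have kras1 r : conjugate_in f x j1 r -> r != j1 x ->
    vle (w1 (j1 x - r)) (w1 (j1 x)).
  (* The conjugate [r] is the image of [x] under some [s] in Gal K, so the Krasner bound applies to
     the pair formed by [s] and the identity. *)
  move=> xr rx; have [q qa|s [gal_s sr]] := @sepcl_gal_conjugate _ _ _ a' r algKt.
    by apply: xr; move: qa; rewrite Da' map_poly_comp fmorph_root.
  have gal1 : is_gal (idfun : {rmorphism sepcl (j1 \o f) -> sepcl (j1 \o f)}).
    by split=> //; exists id.
  have := kras s idfun gal_s gal1; rewrite rmorphB sr [sepcl_incl _ _]Da'; apply=> sa.
  by move: rx; rewrite -sr -sa [sepcl_incl _ _]Da' eqxx.
have krasC := val_sub_conjugate_transfer fv sepx x0 uniq_ad algKt j1v j2v kras1.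
have xS : j2 x \in sepcl_pred F2.
  apply/asboolP; exists (map_poly k p); first by rewrite separable_map.
  by rewrite -map_poly_comp -(eq_map_poly j2f) map_poly_comp fmorph_root.
have aS : j (adjoin_elt (adjoin_incl iota b) a) \in sepcl_pred F2.
  by rewrite -[X in X \in _](subrK (F2 (k d))) -j2x rpredD ?sepcl_base.
exists (Subfield aS) => // s [[_ sM] sw]; apply: contrapT => sa.
(* This is a - d inside the separable closure of K(b), where [s] acts; [s] moves it because it fixes
   d and moves a. *)
pose y := Subfield aS - to_sepcl F2 (k d).
have Dy : sepcl_incl F2 y = j2 x by rewrite j2x rmorphB.
have sy : sepcl_incl F2 (s y) != j2 x.
  rewrite -Dy; apply/eqP => /(fmorph_inj (sepcl_incl F2)).
  by rewrite rmorphB sM => /addIr.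
have conj_sy : conjugate_in f x j2 (sepcl_incl F2 (s y)).
  move=> q qx; have Dq (t : sepcl F2) :
      root (map_poly (j2 \o f) q) (sepcl_incl F2 t)
      = root (map_poly (to_sepcl F2 \o k) q) t.
    rewrite -(fmorph_root (sepcl_incl F2)) -map_poly_comp.
    by rewrite (eq_map_poly j2f).
  rewrite Dq; have -> : map_poly (to_sepcl F2 \o k) q =
      map_poly s (map_poly (to_sepcl F2 \o k) q).
    by rewrite -map_poly_comp; apply: eq_map_poly => c; rewrite /= sM.
  by rewrite fmorph_root -Dq Dy map_poly_comp fmorph_root.
have {krasC} := krasC _ conj_sy sy; apply/negP.
pose bC := F2 (adjoin_elt iota b).
pose aC := j (adjoin_elt (adjoin_incl iota b) a).
have {}lt_ba : ~~ vle (w (bC - aC)) (w (bC - F2 (k d))).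
  move: lt_ba; rewrite /vlt; apply: contra.
  rewrite /bC /aC /F2 /= -!rmorphB.
  by rewrite -[vle (w _) _]/(vle (restrict_val j w _) (restrict_val j w _)) -hw.
pose z := to_sepcl F2 (adjoin_elt iota b) - Subfield aS.
have Dz : sepcl_incl F2 z = bC - aC by rewrite rmorphB.
(* As [s] fixes b and d, (a - d) - s(a - d) = s(b - a) - (b - a), and both terms on the right have
   value v(b - a). *)
have le_diff : vle (w (bC - aC)) (w (j2 x - sepcl_incl F2 (s y))).
  have -> : j2 x - sepcl_incl F2 (s y) = sepcl_incl F2 (s z) - sepcl_incl F2 z.
    rewrite -Dy -!rmorphB; congr (sepcl_incl F2 _).
    rewrite /y /z !rmorphB !sM.
    by rewrite !opprB [RHS]addrC !addrA !subrK.
  by rewrite -Dz; apply: val_leB; rewrite ?sw -[vle _ _]orbb vle_total.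
(* In (a - d) + (b - a) = b - d the sum has smaller value than b - a, so its value is at least that
   of the other summand a - d. *)
have le_xb : vle (w (j2 x)) (w (bC - F2 (k d))).
  have := val_add w (j2 x) (bC - aC).
  have -> : j2 x + (bC - aC) = bC - F2 (k d) by rewrite j2x addrC addrA subrK.
  by rewrite (negPf lt_ba) orbF.
apply: contra lt_ba => sx; apply: vle_trans le_diff _; apply: vle_trans sx _.
exact: le_xb.
Qed.
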